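(* Let $\widetilde G$ be a twisted $D$-dimensional hypercube. Then $\widetilde G$ is adjacency-cospectral and Laplacian-cospectral with the $D$-dimensional hypercube $H_D$ (that is, the adjacency matrices of $\widetilde G$ and $H_D$ have the same eigenvalues with multiplicities, and so do their Laplacians).
   Context: Graphs are finite, simple, unweighted. $H_D$ is the graph on $\mathbb F_2^D$ in which two vertices are adjacent iff they differ in exactly one coordinate ($H_0$ is a single vertex). The Laplacian of a graph is $Lh(x)=\sum_{y\sim x}(h(y)-h(x))$. $S_k^{G}(x)$ denotes the set of vertices at distance exactly $k$ from $x$ in the graph $G$. A connected graph $\widetilde G$ is a twisted $D$-dimensional hypercube if there is a vertex $p\in V(\widetilde G)$ with $D=\deg_{\widetilde G}(p)$ such that, with $L_k=S_k^{\widetilde G}(p)$ for $0\le k\le D$ (and $L_{-1}=L_{D+1}=\varnothing$): (i) $L_0,\dots,L_D$ partition $V(\widetilde G)$, $|L_k|=\binom Dk$ for $0\le k\le D$, and $|V(\widetilde G)|=2^D$; (ii) every $x\in L_k$ has exactly $k$ neighbours in $L_{k-1}$, exactly $D-k$ neighbours in $L_{k+1}$, and no neighbours in $L_k$; (iii) for $1\le k\le D-1$ and any two distinct $x,y\in L_k$, $|S_1^{\widetilde G}(x)\cap S_1^{\widetilde G}(y)\cap L_{k-1}|=|S_1^{\widetilde G}(x)\cap S_1^{\widetilde G}(y)\cap L_{k+1}|\in\{0,1\}$. *)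

(* Defs.v *)
From mathcomp Require Import all_boot all_order all_algebra.

Set Implicit Arguments.
Unset Strict Implicit.
Unset Printing Implicit Defensive.

Import GRing.Theory.

Record sgraph := SGraph {
  vertex :> finType;
  adj : rel vertex;
  adj_sym : symmetric adj;
  adj_irr : irreflexive adj }.

Arguments adj {s}.

Section Distance.
Variable G : sgraph.
Implicit Types x y p : G.

Definition connected_graph : Prop := forall x y, connect adj x y.

Definition degree x := #|[set y | adj x y]|.

Definition walk k x y := [exists s : k.-tuple G, path adj x s && (last x s == y)].

Definition at_distance k x y := walk k x y && [forall j : 'I_k, ~~ walk j x y].

Definition sphere k x : {set G} := [set y | at_distance k x y].

Definition nbrs_in (A : {set G}) x := #|[set y in A | adj x y]|.

Definition common_nbrs_in (A : {set G}) x y := #|sphere 1 x :&: sphere 1 y :&: A|.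

(* Indexed by [int] so that the conventions L_{-1} = L_{D+1} = set0 are built in. *)
Definition layer (D : nat) p (k : int) : {set G} :=
  if k is Posz k' then (if k' <= D then sphere k' p else set0) else set0.

End Distance.

Section TwistedHypercube.
Variables (D : nat) (G : sgraph).

Definition twisted_partition (p : G) : Prop :=
  [/\ partition [set layer D p (k : nat)%:Z | k : 'I_D.+1] [set: G],
      forall k : nat, k <= D -> #|layer D p k| = 'C(D, k)
    & #|G| = 2 ^ D].

Definition twisted_degrees (p : G) : Prop :=
  forall (k : nat) (x : G), k <= D -> x \in layer D p k ->
  [/\ nbrs_in (layer D p (k%:Z - 1)%R) x = k,
      nbrs_in (layer D p (k%:Z + 1)%R) x = D - k
    & nbrs_in (layer D p k) x = 0].

Definition twisted_common_nbrs (p : G) : Prop :=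
  forall (k : nat) (x y : G), 1 <= k -> k < D ->
  x \in layer D p k -> y \in layer D p k -> x != y ->
  common_nbrs_in (layer D p (k%:Z - 1)%R) x y
    = common_nbrs_in (layer D p (k%:Z + 1)%R) x y
  /\ common_nbrs_in (layer D p (k%:Z + 1)%R) x y \in [:: 0; 1].

Definition twisted_hypercube : Prop :=
  connected_graph G /\
  exists p : G, [/\ D = degree p, twisted_partition p, twisted_degrees p
                  & twisted_common_nbrs p].

End TwistedHypercube.

Section Hypercube.
Variable D : nat.

Definition cube_adj : rel 'rV['F_2]_D :=
  fun x y => #|[set i | x ord0 i != y ord0 i]| == 1.

Lemma cube_adj_sym : symmetric cube_adj.
Proof.
move=> x y; rewrite /cube_adj; congr (#|pred_of_set _| == 1).
by apply/setP=> i; rewrite !inE eq_sym.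
Qed.

Lemma cube_adj_irr : irreflexive cube_adj.
Proof.
move=> x; rewrite /cube_adj (_ : [set i | _] = set0) ?cards0 //.
by apply/setP=> i; rewrite !inE eqxx.
Qed.

Definition hypercube : sgraph := SGraph cube_adj_sym cube_adj_irr.

End Hypercube.

Local Open Scope ring_scope.

Section Matrices.
Variables (G : sgraph) (R : nzRingType).

Definition laplacian (h : G -> R) (x : G) : R := \sum_(y | adj x y) (h y - h x).

Definition adjacency_mx : 'M[R]_#|G| :=
  \matrix_(i, j) (adj (enum_val i) (enum_val j))%:R.

(* Column j is the image under the Laplacian of the indicator of vertex j. *)
Definition laplacian_mx : 'M[R]_#|G| :=
  \matrix_(i, j) laplacian (fun y => (y == enum_val j)%:R) (enum_val i).

Lemma laplacian_mxE (h : G -> R) :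
  laplacian_mx *m \col_j h (enum_val j) = \col_i laplacian h (enum_val i).
Proof.
apply/colP=> i; rewrite !mxE.
under eq_bigr do rewrite !mxE /laplacian mulr_suml.
rewrite exchange_big /=; apply: eq_bigr => y _.
have pick_val z : \sum_(j < #|G|) (z == enum_val j)%:R * h (enum_val j) = h z.
  rewrite (bigD1 (enum_rank z)) //= enum_rankK eqxx mul1r big1 ?addr0 // => j nj.
  case: eqP => [zj | _]; last by rewrite mul0r.
  by rewrite zj enum_valK eqxx in nj.
by under eq_bigr do rewrite mulrBl; rewrite sumrB !pick_val.
Qed.

End Matrices.

Section Spectrum.
Variable F : fieldType.

Definition eigenvalue_mult n (A : 'M[F]_n) (a : F) : nat := mup a (char_poly A).

Lemma eigenvalue_multE n (A : 'M[F]_n) a : eigenvalue A a = (0 < eigenvalue_mult A a)%N.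
Proof.
by rewrite eigenvalue_root_char mup_geq ?monic_neq0 ?char_poly_monic // expr1 dvdp_XsubCl.
Qed.

Definition cospectral m n (A : 'M[F]_m) (B : 'M[F]_n) : Prop :=
  forall a : F, eigenvalue_mult A a = eigenvalue_mult B a.

End Spectrum.

Definition adjacency_cospectral (F : fieldType) (G H : sgraph) : Prop :=
  cospectral (adjacency_mx G F) (adjacency_mx H F).

Definition laplacian_cospectral (F : fieldType) (G H : sgraph) : Prop :=
  cospectral (laplacian_mx G F) (laplacian_mx H F).

(* Main.v *)
(** Split the adjacency matrix of a twisted hypercube as [E + F], where [E]
    raises and [F] lowers the distance to [p].  The local conditions (ii) and
    (iii) say exactly that [E F - F E] is the diagonal matrix [H] with entry
    [D - 2 k] on the layer [L_k], so that [(E, H, F)] is an sl2-triple.  Hence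
    [E + F] is conjugate to [H], by products of exponentials of the nilpotent
    [E] and [F], and its spectrum is determined by the layer sizes.  For the
    hypercube itself the characters of [F_2^D] give the same spectrum.  Both
    graphs are [D]-regular, so the Laplacians are the adjacency matrices
    shifted by [- D]. *)

Require Import Defs.
From mathcomp Require Import all_boot all_order all_algebra.
From mathcomp Require Import ring zify.

Set Implicit Arguments.
Unset Strict Implicit.
Unset Printing Implicit Defensive.

Import Order.TTheory GRing.Theory Num.Theory.
Local Open Scope ring_scope.

(** * Truncated exponentials in an algebra over a field of characteristic zero *)

Section TruncatedExponential.
Variables (F : numFieldType) (A : algType F).
Implicit Types (x e f h : A) (N k : nat).

(** The first [N] terms of the exponential series; this is the full exponential once
    [x ^+ N = 0]. *)
Definition exp_trunc N x : A := \sum_(k < N) (k`!%:R : F)^-1 *: x ^+ k.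

Lemma exp_truncS N x :
  exp_trunc N.+1 x = exp_trunc N x + (N`!%:R : F)^-1 *: x ^+ N.
Proof. by rewrite /exp_trunc big_ord_recr. Qed.

Lemma exp_trunc_nil N x : x ^+ N = 0 -> exp_trunc N.+1 x = exp_trunc N x.
Proof. by move=> xN; rewrite exp_truncS xN scaler0 addr0. Qed.

Lemma mulr_exp_trunc N x : x * exp_trunc N x = exp_trunc N x * x.
Proof.
rewrite /exp_trunc mulr_sumr mulr_suml; apply: eq_bigr => k _.
by rewrite -scalerAl -scalerAr -exprS -exprSr.
Qed.

Lemma invf_factS k : (k.+1`!%:R : F)^-1 * k.+1%:R = k`!%:R^-1.
Proof.
rewrite factS natrM invfM mulrAC mulVf ?mul1r //.
by rewrite pnatr_eq0.
Qed.

(** The Euler operator [x d/dx] applied termwise to the series; the truncation order drops by one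
    because differentiation lowers degrees. *)
Lemma exp_trunc_deriv N x :
  \sum_(k < N.+1) ((k`!%:R : F)^-1 * k%:R) *: x ^+ k = x * exp_trunc N x.
Proof.
rewrite big_ord_recl mulr0 scale0r add0r /exp_trunc mulr_sumr.
by apply: eq_bigr => k _; rewrite lift0 invf_factS exprS scalerAr.
Qed.

(** The exponential is [1 - r * x] with [r] a polynomial in [x], so [r * x] is nilpotent and a
    finite geometric series is an inverse. *)
Lemma exp_trunc_unit N x : x ^+ N = 0 -> exists y, exp_trunc N.+1 x * y = 1.
Proof.
move=> xN; pose r := - \sum_(k < N) (k.+1`!%:R : F)^-1 *: x ^+ k.
have rx : GRing.comm r x.
  rewrite /GRing.comm mulNr mulrN mulr_sumr mulr_suml; congr (- _).
  by apply: eq_bigr => k _; rewrite -scalerAl -scalerAr -exprS -exprSr.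
have -> : exp_trunc N.+1 x = 1 - r * x.
  rewrite /exp_trunc big_ord_recl invr1 scale1r mulNr opprK mulr_suml.
  by congr (_ + _); apply: eq_bigr => k _; rewrite lift0 exprSr scalerAl.
exists (\sum_(i < N) (r * x) ^+ i).
have := subrX1 (r * x) N; rewrite exprMn_comm // xN mulr0 sub0r.
by rewrite -[_ - 1]opprB mulNr => /oppr_inj <-.
Qed.

Lemma commutator_expr h x (c : F) k :
  h * x = x * h + c *: x -> h * x ^+ k = x ^+ k * h + (c * k%:R) *: x ^+ k.
Proof.
move=> hx; elim: k => [|k IH]; first by rewrite mulr0 scale0r addr0 mulr1 mul1r.
rewrite exprS mulrA hx mulrDl -mulrA IH mulrDr !mulrA -addrA; congr (_ + _).
by rewrite -scalerAr -scalerAl -!exprS -scalerDl -[k.+1]addn1 natrD mulrDr mulr1.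
Qed.

(** The commutator with [h] multiplies [x ^+ k] by [c * k], hence acts on series in [x] as [c] times
    the Euler operator. *)
Lemma commutator_exp_trunc h x (c : F) N : h * x = x * h + c *: x ->
  h * exp_trunc N.+1 x = exp_trunc N.+1 x * h + c *: (x * exp_trunc N x).
Proof.
move=> hx; rewrite -exp_trunc_deriv scaler_sumr /exp_trunc mulr_sumr mulr_suml.
rewrite -big_split; apply: eq_bigr => k _ /=.
rewrite -scalerAr (commutator_expr _ hx) scalerDr scalerAl; congr (_ + _).
by rewrite !scalerA mulrCA mulrA.
Qed.

(** * Conjugation inside an sl2-triple *)

Section SL2.
Variables (e f h : A).
Hypotheses (ef : e * f = f * e + h) (he : h * e = e * h + 2%:R *: e)
  (hf : h * f = f * h + (- 2%:R) *: f).

(** Moving [f] through the product leaves the sum of [e ^+ j * h * e ^+ (k - j)] over [j <= k].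
    Moving [h] to the left costs [2 j] copies of [e ^+ k] in each term, [k (k + 1)] in total. *)
Lemma sl2_expr_commutator k : e ^+ k.+1 * f =
  f * e ^+ k.+1 + k.+1%:R *: (h * e ^+ k) - (k.+1 * k)%:R *: e ^+ k.
Proof.
elim: k => [|k IH].
  by rewrite !expr1 !expr0 muln0 scale0r subr0 mulr1 scale1r.
have eh : e * h = h * e - 2%:R *: e by rewrite he addrK.
rewrite exprS -mulrA IH mulrBr mulrDr [e * (f * _)]mulrA ef mulrDl.
rewrite -[f * e * _]mulrA -exprS.
rewrite -!scalerAr [e * (h * _)]mulrA eh mulrBl -[h * e * _]mulrA.
rewrite -scalerAl -!exprS.
rewrite scalerBr !addrA -[_ + h * _ + _]addrA -[X in X + _ *: (h * _)]scale1r.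
rewrite -scalerDl scalerA -[_ - _ - _]addrA -opprD -scalerDl.
rewrite -natrM -natrD nat1r (_ : (_ + _)%N = (k.+2 * k.+1)%N) //.
by rewrite -mulnDr mulnC.
Qed.

Lemma sl2_exp_trunc_commutator N : exp_trunc N.+2 e * f =
  f * exp_trunc N.+2 e + h * exp_trunc N.+1 e - e * exp_trunc N e.
Proof.
rewrite -exp_trunc_deriv {1 2}/exp_trunc !(big_ord_recl N.+1) mulrDl mulrDr.
rewrite -scalerAl -scalerAr mul1r mulr1 -!addrA; congr (_ + _).
rewrite addrA /exp_trunc !mulr_sumr !mulr_suml -big_split -sumrB.
apply: eq_bigr => k _ /=; rewrite /bump /= add1n.
rewrite -!scalerAl sl2_expr_commutator scalerBr scalerDr -!scalerAr !scalerA.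
by rewrite natrM mulrA invf_factS.
Qed.

(* [Ad (exp e)] sends [e + f] to [f + h], and [Ad (exp (- f / 2))] sends [f + h] to [h]. *)
Lemma sl2_conj N : e ^+ N = 0 -> f ^+ N = 0 ->
  exists u v, u * v = 1 /\ u * (e + f) = h * u.
Proof.
(* The factor [- 1 / 2] is chosen so that [- 2 g = f]: the commutator of [h] with [exp g] is then
   exactly [f * exp g]. *)
move=> eN fN; pose g : A := (- 2%:R^-1 : F) *: f.
have nz2 : (2%:R : F) != 0 by rewrite pnatr_eq0.
have gf : (- 2%:R : F) *: g = f by rewrite scalerA mulrNN mulfV // scale1r.
have hg : h * g = g * h + (- 2%:R : F) *: g.
  by rewrite -scalerAr hf scalerDr scalerAl !scalerA mulrC.
have gN : g ^+ N = 0 by rewrite exprZn fN scaler0.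
have [p' pp'] := exp_trunc_unit eN; have [q' qq'] := exp_trunc_unit gN.
set p := exp_trunc _ _ in pp'; set q := exp_trunc _ _ in qq'.
have pf : p * f = f * p + h * p - e * p.
  (* Since [e ^+ N = 0], the truncations of orders [N], [N + 1] and [N + 2] in this identity
     coincide. *)
  have := sl2_exp_trunc_commutator N.
  by rewrite !exp_trunc_nil // ?exprS ?eN ?mulr0 // -(exp_trunc_nil eN).
have hq : h * q = q * (f + h).
  rewrite (commutator_exp_trunc N hg) scalerAl gf mulrDr addrC -(exp_trunc_nil gN).
  congr (_ + _); rewrite -gf -scalerAl -scalerAr; congr (_ *: _).
  exact: mulr_exp_trunc.
exists (q * p), (p' * q'); split.
  by rewrite -mulrA [p * _]mulrA pp' mul1r.
rewrite -mulrA mulrDr pf -mulr_exp_trunc -/p.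
by rewrite addrC subrK -mulrDl mulrA -hq mulrA.
Qed.

End SL2.

End TruncatedExponential.

(** * Characteristic polynomials of similar matrices *)

Section CharPolySimilar.
Variable F : fieldType.

Lemma char_poly_similar n (P A B : 'M[F]_n) :
  P \in unitmx -> P *m A = B *m P -> char_poly A = char_poly B.
Proof.
move=> uP PA; pose Q := map_mx polyC P.
have QA : Q *m char_poly_mx A = char_poly_mx B *m Q.
  by rewrite /char_poly_mx mulmxBr mulmxBl -!map_mxM PA scalar_mxC.
have /(congr1 determinant) := QA; rewrite !det_mulmx mulrC => /mulIf; apply.
by rewrite det_map_mx polyC_eq0 -unitfE -unitmxE.
Qed.

Lemma char_poly_similar_diag n (P A : 'M[F]_n) (d : 'rV_n) :
  P \in unitmx -> P *m A = diag_mx d *m P ->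
  char_poly A = \prod_i ('X - (d 0 i)%:P).
Proof.
move=> uP PA; rewrite (char_poly_similar uP PA) char_poly_trig ?diag_mx_is_trig //.
by apply: eq_bigr => i _; rewrite mxE eqxx mulr1n.
Qed.

End CharPolySimilar.

(** * Matrices that shift a grading of the index set *)

Section GradedMatrices.
Variable F : numFieldType.

(** A nonzero entry of [e ^+ k] joins levels that differ by [k], and no two levels differ by more
    than [D]. *)
Lemma graded_mx_nilpotent n (e : 'M[F]_n.+1) (lv : 'I_n.+1 -> nat) D :
  (forall i, lv i <= D)%N -> (forall i j, e i j != 0 -> lv j = (lv i).+1) ->
  e ^+ D.+1 = 0.
Proof.
move=> lvD e1; have ek k i j : (e ^+ k) i j != 0 -> lv j = (lv i + k)%N.
  elim: k i j => [|k IH] i j.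
    by rewrite mxE addn0; case: (i =P j) => [->|]; rewrite ?eqxx.
  rewrite exprS mxE => nz; have /existsP[l] : [exists l, e i l * (e ^+ k) l j != 0].
    apply: contraNT nz => /existsPn z; rewrite big1 // => l _.
    by apply/eqP; rewrite -[_ == _]negbK z.
  by rewrite mulf_eq0 negb_or => /andP[/e1 il /IH->]; rewrite il addSnnS.
apply/matrixP=> i j; rewrite [RHS]mxE; apply/eqP; apply: contraTT (lvD j).
by move=> /ek->; rewrite -ltnNge addnS ltnS leq_addl.
Qed.

(** The grading alone yields the relations of [h] with [e] and [f], because the diagonal of [h] is
    affine in the level with slope [- 2]. Only the commutator of [e] and [f] has to be supplied. *)
Lemma graded_sl2_diag n (e f : 'M[F]_n) (lv : 'I_n -> nat) D
    (h := diag_mx (\row_i (D%:R - 2%:R * (lv i)%:R)) : 'M[F]_n) :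
  (forall i, lv i <= D)%N -> (forall i j, e i j != 0 -> lv j = (lv i).+1) ->
  (forall i j, f i j != 0 -> lv i = (lv j).+1) -> e *m f = f *m e + h ->
  exists2 P, P \in unitmx & P *m (e + f) = h *m P.
Proof.
(* Square matrices form a nonzero ring only in positive size, so the empty matrix is treated
   apart. *)
case: n => [|n] in e f lv h * => lvD e1 f1 ef.
  by exists 1%:M; [rewrite unitmx1 | rewrite [LHS]flatmx0 [RHS]flatmx0].
have eN := graded_mx_nilpotent lvD e1.
have fN : f ^+ D.+1 = 0.
  (* For the reversed grading [D - lv i], the lowering matrix [f] is a raising one. *)
  apply: (@graded_mx_nilpotent _ _ (fun i => D - lv i)%N) => [i|i j /f1 ij].
    exact: leq_subr.
  by have := lvD i; rewrite ij; lia.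
have he : h * e = e * h + 2%:R *: e.
  apply/matrixP=> i j; rewrite -!mulmxE mul_diag_mx mul_mx_diag !mxE.
  have [->|/e1->] := eqVneq (e i j) 0; first by rewrite !(mul0r, mulr0) addr0.
  by rewrite -natr1; ring.
have hf : h * f = f * h + (- 2%:R) *: f.
  apply/matrixP=> i j; rewrite -!mulmxE mul_diag_mx mul_mx_diag !mxE.
  have [->|/f1->] := eqVneq (f i j) 0; first by rewrite !(mul0r, mulr0) addr0.
  by rewrite -natr1; ring.
have [P [Q [PQ PA]]] := sl2_conj (ef : e * f = f * e + h) he hf eN fN.
by exists P => //; have [] := mulmx1_unit (PQ : P *m Q = 1%:M).
Qed.

End GradedMatrices.

Lemma sum_enum_val (V : nmodType) (T : finType) (f : T -> V) :
  \sum_(i < #|T|) f (enum_val i) = \sum_x f x.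
Proof. by rewrite [RHS](reindex _ (onW_bij _ (enum_val_bij T))). Qed.

(** * From a diagonalization by levels to the characteristic polynomials *)

Section LevelSpectrum.
Variables (F : numFieldType) (G : sgraph) (D : nat) (lv : G -> nat).
Hypotheses (lv_le : forall x, (lv x <= D)%N)
  (card_lv : forall k, (k <= D)%N -> #|[set x | lv x == k]| = 'C(D, k))
  (deg : forall x : G, degree x = D).

Lemma prod_level (R : comNzRingType) (g : nat -> R) :
  \prod_(i < #|G|) g (lv (enum_val i)) = \prod_(k < D.+1) g k ^+ 'C(D, k).
Proof.
have -> : \prod_(i < #|G|) g (lv (enum_val i)) = \prod_x g (lv x).
  by rewrite [RHS](reindex _ (onW_bij _ (enum_val_bij G))).
rewrite (partition_big (fun x => inord (lv x) : 'I_D.+1) xpredT) //=.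
apply: eq_bigr => k _; rewrite -(card_lv (ltn_ord k)) -prodr_const.
apply: eq_big => x; rewrite ?inE -val_eqE /= inordK // ?ltnS //.
by move/eqP->.
Qed.

Lemma laplacian_mx_regular : laplacian_mx G F = adjacency_mx G F - D%:R%:M.
Proof.
apply/matrixP=> i j; rewrite !mxE /laplacian sumrB sumr_const.
have -> : #|[pred y | adj (enum_val i) y]| = D.
  by rewrite -[RHS](deg (enum_val i)); apply: eq_card => y; rewrite !inE.
congr (_ - _); last by rewrite (inj_eq enum_val_inj) -mulrnA mulnC mulrnA.
rewrite big_mkcond (bigD1 (enum_val j)) //= eqxx big1 ?addr0; first by case: adj.
by move=> y /negPf->; case: adj.
Qed.

(** By regularity the Laplacian differs from the adjacency matrix by a scalar matrix, so the same
    [P] diagonalizes both. *)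
Lemma level_char_poly (P : 'M[F]_#|G|) : P \in unitmx ->
  P *m adjacency_mx G F
    = diag_mx (\row_i (D%:R - 2%:R * (lv (enum_val i))%:R)) *m P ->
  char_poly (adjacency_mx G F)
    = \prod_(k < D.+1) ('X - (D%:R - 2%:R * k%:R)%:P) ^+ 'C(D, k)
  /\ char_poly (laplacian_mx G F)
    = \prod_(k < D.+1) ('X - (- (2%:R * k%:R))%:P) ^+ 'C(D, k).
Proof.
move=> uP PA; split.
  rewrite (char_poly_similar_diag uP PA).
  rewrite -(prod_level (fun k => 'X - (D%:R - 2%:R * k%:R : F)%:P)).
  by apply: eq_bigr => i _; rewrite mxE.
pose d : 'rV[F]_#|G| := \row_i (- (2%:R * (lv (enum_val i))%:R)).
have PL : P *m laplacian_mx G F = diag_mx d *m P.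
  rewrite laplacian_mx_regular mulmxBr PA scalar_mxC -mulmxBl; congr (_ *m _).
  by apply/matrixP=> i j; rewrite !mxE; case: eqP => _; rewrite ?mulr0n ?mulr1n; ring.
rewrite (char_poly_similar_diag uP PL).
rewrite -(prod_level (fun k => 'X - (- (2%:R * k%:R) : F)%:P)).
by apply: eq_bigr => i _; rewrite mxE.
Qed.

End LevelSpectrum.

(** * Walks and distances *)

Section Walks.
Variable G : sgraph.
Implicit Types x y z : G.

Lemma walk0 x y : walk 0 x y = (x == y).
Proof.
apply/existsP/eqP=> [[s]|->]; first by rewrite tuple0 => /eqP.
by exists [tuple]; rewrite /= eqxx.
Qed.

Lemma walk1 x y : walk 1 x y = adj x y.
Proof.
apply/existsP/idP=> [[s]|xy].
  by case/tupleP: s => z s; rewrite tuple0 /= andbT => /andP[xz /eqP <-].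
by exists [tuple y]; rewrite /= xy eqxx.
Qed.

Lemma walk_rcons k x y z : walk k x y -> adj y z -> walk k.+1 x z.
Proof.
case/existsP=> s /andP[ps /eqP ly] yz; apply/existsP; exists [tuple of rcons s z].
by rewrite /= rcons_path ps ly yz last_rcons eqxx.
Qed.

Lemma in_sphere1 x y : (y \in sphere 1 x) = adj x y.
Proof.
rewrite inE /at_distance walk1; case xy: (adj x y) => //=.
apply/forallP=> j; rewrite ord1 walk0; apply: contraTneq xy => ->.
by rewrite adj_irr.
Qed.

Lemma at_distance_le k l x y : at_distance k x y -> walk l x y -> (k <= l)%N.
Proof.
case/andP=> _ /forallP nw wl; rewrite leqNgt; apply/negP => lk.
by have := nw (Ordinal lk); rewrite wl.
Qed.

Lemma at_distance_inj k l x y : at_distance k x y -> at_distance l x y -> k = l.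
Proof.
move=> dk dl; apply/eqP; rewrite eqn_leq !(at_distance_le dk, at_distance_le dl) //.
  by case/andP: dk.
by case/andP: dl.
Qed.

End Walks.

(** * The sl2-triple of a twisted hypercube *)

Section TwistedLevels.
Variables (D : nat) (G : sgraph) (p : G) (lv : G -> nat).
Hypotheses (lv_le : forall x, (lv x <= D)%N)
  (lvP : forall x, x \in sphere (lv x) p).

Lemma in_layer (k : nat) x : (x \in layer D p k) = (lv x == k).
Proof.
rewrite /layer; case: leqP => kD.
  apply/idP/eqP=> [|<-]; last exact: lvP.
  by have := lvP x; rewrite !inE; apply: at_distance_inj.
by rewrite inE; apply/esym/negbTE; rewrite neq_ltn (leq_ltn_trans (lv_le x) kD).
Qed.

Lemma in_layerS (k : nat) x : (x \in layer D p (k%:Z + 1)) = (lv x == k.+1).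
Proof. by rewrite -in_layer -PoszD addn1. Qed.

(** The successor is on the side of [lv x] so that [k = 0] is covered: the layer of index [- 1] is
    empty and no successor is zero. *)
Lemma in_layer_pred (k : nat) x : (x \in layer D p (k%:Z - 1)) = ((lv x).+1 == k).
Proof.
case: k => [|k]; first by rewrite sub0r inE.
by rewrite -addn1 PoszD addrK in_layer addn1.
Qed.

Lemma lv_adj_le x y : adj x y -> (lv y <= (lv x).+1)%N.
Proof.
move=> xy; have := lvP x; have := lvP y; rewrite !inE => dy /andP[wx _].
exact: at_distance_le dy (walk_rcons wx xy).
Qed.

Hypotheses (deg : twisted_degrees D p) (com : twisted_common_nbrs D p)
  (card_layer : forall k : nat, (k <= D)%N -> #|layer D p k| = 'C(D, k)).

Lemma twisted_card_lv k : (k <= D)%N -> #|[set x | lv x == k]| = 'C(D, k).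
Proof.
by move=> kD; rewrite -card_layer //; apply: eq_card => x; rewrite in_layer inE.
Qed.

Lemma twisted_nbrs_down x : #|[set y | adj x y & lv x == (lv y).+1]| = lv x.
Proof.
have /(deg (lv_le x))[d _ _] : x \in layer D p (lv x) by rewrite in_layer.
by rewrite -[RHS]d; apply: eq_card => y; rewrite !inE in_layer_pred andbC [(lv y).+1 == _]eq_sym.
Qed.

Lemma twisted_nbrs_up x : #|[set y | adj x y & lv y == (lv x).+1]| = (D - lv x)%N.
Proof.
have /(deg (lv_le x))[_ d _] : x \in layer D p (lv x) by rewrite in_layer.
by rewrite -[RHS]d; apply: eq_card => y; rewrite !inE in_layerS andbC.
Qed.

(** Distances to [p] differ by at most one along an edge, and condition (ii) excludes edges inside a
    layer. *)
Lemma twisted_adj_lv x y : adj x y -> (lv y == (lv x).+1) || (lv x == (lv y).+1).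
Proof.
move=> xy; have := lv_adj_le xy; have := lv_adj_le (y := x) (x := y).
rewrite adj_sym => /(_ xy) yx xy1; have : lv y != lv x; last by lia.
have /(deg (lv_le x))[_ _ /eqP] : x \in layer D p (lv x) by rewrite in_layer.
rewrite cards_eq0 => /eqP/setP/(_ y).
by rewrite !inE in_layer xy andbT => ->.
Qed.

Lemma twisted_degree (x : G) : degree x = D.
Proof.
rewrite /degree -(cardsID [set y | lv x == (lv y).+1]) -[RHS](subnKC (lv_le x)).
congr (_ + _)%N; [rewrite -[RHS]twisted_nbrs_down | rewrite -[RHS]twisted_nbrs_up].
  by apply: eq_card => y; rewrite !inE.
apply: eq_card => y; rewrite !inE andbC; case xy: (adj x y) => //=.
by have := twisted_adj_lv xy; lia.
Qed.

(** Condition (iii) gives this for [0 < k < D]. The layers [0] and [D] are singletons, so they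
    contain no two distinct vertices. *)
Lemma twisted_common x y : lv x = lv y -> x != y ->
  #|[set z | [&& adj x z, adj y z & lv x == (lv z).+1]]|
    = #|[set z | [&& adj x z, adj y z & lv z == (lv x).+1]]|.
Proof.
move=> lxy nxy.
have not1 : 'C(D, lv x) != 1%N.
  apply: contraNneq nxy; rewrite -twisted_card_lv // => /eqP/cards1P[z zP].
  have /set1P-> : x \in [set z] by rewrite -zP inE.
  by have /set1P-> : y \in [set z] by rewrite -zP inE lxy.
have x0 : (0 < lv x)%N by rewrite lt0n; apply: contraNneq not1 => ->; rewrite bin0.
have xD : (lv x < D)%N.
  by rewrite ltn_neqAle lv_le andbT; apply: contraNneq not1 => ->; rewrite binn.
have xl : x \in layer D p (lv x) by rewrite in_layer.
have yl : y \in layer D p (lv x) by rewrite in_layer lxy.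
have [cxy _] := com x0 xD xl yl nxy; rewrite /common_nbrs_in in cxy.
transitivity #|sphere 1 x :&: sphere 1 y :&: layer D p ((lv x)%:Z - 1)|.
  apply: eq_card => z; rewrite !(in_setI, in_sphere1, in_layer_pred) inE -andbA.
  by rewrite [(lv z).+1 == _]eq_sym.
rewrite cxy; apply: eq_card => z.
by rewrite !(in_setI, in_sphere1, in_layerS) inE -andbA.
Qed.

Lemma twisted_diag (F : numFieldType) : exists2 P : 'M[F]_#|G|, P \in unitmx &
  P *m adjacency_mx G F
    = diag_mx (\row_i (D%:R - 2%:R * (lv (enum_val i))%:R)) *m P.
Proof.
pose up (x y : G) := adj x y && (lv y == (lv x).+1).
pose e : 'M[F]_#|G| := \matrix_(i, j) (up (enum_val i) (enum_val j))%:R.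
have -> : adjacency_mx G F = e + e^T.
  apply/matrixP=> i j; rewrite !mxE /up [adj (enum_val j) _]adj_sym.
  case xy: (adj (enum_val i) _) => /=; last by rewrite addr0.
  have := twisted_adj_lv xy; case: eqP => [-> _|_ /= ->]; last by rewrite add0r.
  by rewrite ltn_eqF ?addr0 // ltnW.
have e1 i j : e i j != 0 -> lv (enum_val j) = (lv (enum_val i)).+1.
  by rewrite mxE /up; case: (lv _ =P _) => // _; rewrite andbF eqxx.
apply: (graded_sl2_diag (D := D) (lv := lv \o enum_val)) => // [i|i j|].
- exact: lv_le.
- by rewrite mxE; apply: e1.
apply/matrixP=> i j; rewrite !mxE /=.
set x := enum_val i; set y := enum_val j.
(* Entries of a product of two 0-1 matrices count common neighbours: upper ones for [e *m e^T],
   lower ones for [e^T *m e]. *)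
have count (a b : rel G) :
    \sum_(k < #|G|) (a x (enum_val k))%:R * (b y (enum_val k))%:R
    = #|[set z | a x z & b y z]|%:R :> F.
  transitivity (\sum_z (a x z)%:R * (b y z)%:R : F).
    exact: (sum_enum_val (fun z => (a x z)%:R * (b y z)%:R : F)).
  rewrite -sum1_card natr_sum.
  rewrite [RHS]big_mkcond /=; apply: eq_bigr => z _; rewrite inE.
  by case: (a x z); case: (b y z); rewrite /= ?mulr1 ?mulr0.
under eq_bigr do rewrite !mxE; rewrite count.
under eq_bigr do rewrite !mxE.
rewrite (count (fun x y => up y x) (fun x y => up y x)).
(* Off the diagonal the two counts must agree: by [twisted_common] within a level, and because both
   vanish between different levels. On the diagonal the identity is [D - k = k + (D - 2 k)]. *)
have [ij|nij] := eqVneq i j; last first.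
  rewrite mulr0n addr0; congr (_%:R).
  have nxy : x != y by rewrite (inj_eq enum_val_inj).
  have [lxy|nlxy] := eqVneq (lv x) (lv y).
    rewrite /up.
    transitivity #|[set z | [&& adj x z, adj y z & lv z == (lv x).+1]]|.
      by apply: eq_card => z; rewrite !inE -lxy; case: adj; case: adj; case: eqP.
    rewrite -twisted_common //; apply: eq_card => z.
    by rewrite !inE -lxy ![adj z _]adj_sym; case: adj; case: adj; case: eqP.
  by rewrite !eq_card0 // => z; rewrite !inE /up; apply: contraNF nlxy
    => /andP[/andP[_ /eqP lx] /andP[_ /eqP ly]]; apply/eqP; lia.
rewrite /y -ij -/x mulr1n.
have -> : #|[set z | up x z & up x z]| = (D - lv x)%N.
  by rewrite -twisted_nbrs_up; apply: eq_card => z; rewrite !inE andbb.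
have -> : #|[set z | up z x & up z x]| = lv x.
  rewrite -[RHS]twisted_nbrs_down; apply: eq_card => z.
  by rewrite !inE andbb /up adj_sym.
by rewrite natrB //; ring.
Qed.

End TwistedLevels.

Lemma twisted_char_poly (F : numFieldType) D (G : sgraph) : twisted_hypercube D G ->
  char_poly (adjacency_mx G F)
    = \prod_(k < D.+1) ('X - (D%:R - 2%:R * k%:R)%:P) ^+ 'C(D, k)
  /\ char_poly (laplacian_mx G F)
    = \prod_(k < D.+1) ('X - (- (2%:R * k%:R))%:P) ^+ 'C(D, k).
Proof.
case=> _ [p [_ [part card_layer _] deg com]].
(* The level function is obtained by choice from the fact that the layers cover all vertices. *)
have ex_lv x : exists k : 'I_D.+1, x \in sphere k p.
  have : x \in cover [set layer D p (k : nat)%:Z | k : 'I_D.+1].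
    by rewrite (cover_partition part) inE.
  case/bigcupP=> _ /imsetP[k _ ->].
  by rewrite /layer -ltnS ltn_ord => xk; exists k.
have [lv lvP] := fin_all_exists ex_lv.
have lv_le x : (lv x <= D)%N by rewrite -ltnS ltn_ord.
have [P uP PA] := twisted_diag lv_le lvP deg com card_layer F.
apply: (level_char_poly (lv := fun x => lv x) lv_le _ _ uP PA) => [k|x].
  exact: twisted_card_lv lv_le lvP card_layer k.
exact: twisted_degree lv_le lvP deg x.
Qed.

(** * The hypercube and its characters *)

Section Cube.
Variable D : nat.
Implicit Types (x y s t : 'rV['F_2]_D) (i j : 'I_D).

Definition flip i x : 'rV['F_2]_D := x + delta_mx 0 i.

Definition weight x : nat := #|[set i | x 0 i != 0]|.

Lemma flipE i x j : flip i x 0 j = x 0 j + (i == j)%:R.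
Proof. by rewrite !mxE eqxx eq_sym. Qed.

Lemma F2_addrr (a : 'F_2) : a + a = 0.
Proof. by apply/val_inj; case: a => [[|[|[]]]]. Qed.

Lemma F2_neq (a b : 'F_2) : (a != b) = (a == b + 1).
Proof. by case: a b => [[|[|[]]] // ?] [[|[|[]]]]. Qed.

Lemma flipK i : involutive (flip i).
Proof. by move=> x; apply/rowP=> j; rewrite !flipE -addrA F2_addrr addr0. Qed.

Lemma flip_inj x : injective (flip^~ x).
Proof.
move=> i j /rowP/(_ j); rewrite !flipE eqxx => /addrI.
by case: (i =P j).
Qed.

Lemma cube_adj_flip x y : cube_adj x y = (y \in [set flip i x | i : 'I_D]).
Proof.
apply/cards1P/imsetP=> [[i xy]|[i _ ->]]; exists i => //.
  apply/rowP=> j; rewrite flipE; have /setP/(_ j) := xy.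
  rewrite !inE eq_sym [j == i]eq_sym; case: (i == j).
    by rewrite F2_neq => /eqP.
  by rewrite addr0 => /negbFE/eqP.
apply/setP=> j; rewrite !inE flipE eq_sym [j == i]eq_sym.
by case: (i == j); [rewrite F2_neq eqxx | rewrite addr0 eqxx].
Qed.

Lemma sum_cube_adj (V : nmodType) (f : 'rV['F_2]_D -> V) x :
  \sum_(y | cube_adj x y) f y = \sum_i f (flip i x).
Proof.
rewrite (eq_bigl _ _ (cube_adj_flip x)) big_imset //= => i j _ _.
exact: flip_inj.
Qed.

Lemma cube_degree (x : hypercube D) : degree x = D.
Proof.
rewrite /degree -sum1_card (eq_bigl (cube_adj x)) => [|y]; last by rewrite inE.
by rewrite sum_cube_adj sum1_card card_ord.
Qed.

Lemma weight_le x : (weight x <= D)%N.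
Proof. by rewrite -[leqRHS]card_ord max_card. Qed.

(** Over the two-element field a vector is determined by its support, so vectors of weight [k]
    correspond to [k]-subsets of the coordinates. *)
Lemma card_weight k : #|[set x | weight x == k]| = 'C(D, k).
Proof.
pose supp x := [set i | x 0 i != 0].
pose ind (A : {set 'I_D}) : 'rV['F_2]_D := \row_i (i \in A)%:R.
have suppK : cancel supp ind.
  move=> x; apply/rowP=> i; rewrite mxE inE.
  by case: eqP => [->|/eqP] //=; rewrite F2_neq add0r => /eqP->.
have indK : cancel ind supp.
  by move=> A; apply/setP=> i; rewrite inE mxE; case: (i \in A).
rewrite -[in RHS](card_ord D) -card_draws -(card_imset _ (can_inj suppK)).
apply: eq_card => A; rewrite -[A]indK mem_imset ?inE //; exact: can_inj suppK.
Qed.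

Variable F : numFieldType.

(** The character of the additive group sending [x] to [-1] to the power of the inner product of [s]
    and [x]. *)
Definition walsh s x : F := \prod_i (-1) ^+ ((s 0 i != 0) && (x 0 i != 0)).

Lemma walshC s x : walsh s x = walsh x s.
Proof. by apply: eq_bigr => i _; rewrite andbC. Qed.

Lemma walsh_sqr s x : walsh s x * walsh s x = 1.
Proof. by rewrite -big_split big1 // => i _; rewrite /= -expr2 sqrr_sign. Qed.

Lemma walsh_flip s i x : walsh s (flip i x) = (-1) ^+ (s 0 i != 0) * walsh s x.
Proof.
rewrite /walsh (bigD1 i) //= [X in _ = _ * X](bigD1 i) //= mulrA; congr (_ * _).
  rewrite flipE eqxx -signr_addb; congr (_ ^+ _); congr nat_of_bool.
  have -> : (x 0 i + 1 != 0) = ~~ (x 0 i != 0).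
    by case: (x 0 i) => [[|[|[]]]].
  by case: (s 0 i != 0); case: (x 0 i != 0).
by apply: eq_bigr => j ji; rewrite flipE [i == j]eq_sym (negPf ji) addr0.
Qed.

(** If [s] and [t] differ at [i], the substitution [flip i] negates every term, so the sum equals
    its own opposite and vanishes in characteristic zero. *)
Lemma walsh_orthogonal s t :
  \sum_x walsh s x * walsh t x = (#|{: 'rV['F_2]_D}| * (s == t))%:R.
Proof.
have [<-|nst] := eqVneq s t.
  by rewrite muln1; under eq_bigr do rewrite walsh_sqr; rewrite sumr_const.
have [i sti] : exists i, s 0 i != t 0 i.
  apply/existsP; apply: contraNT nst => /existsPn st.
  by apply/eqP/rowP=> i; apply/eqP/negPn.
set S := \sum_x _; suff SN : S = - S.
  by apply/eqP; rewrite muln0 -eqNr -SN.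
rewrite {1}/S (reindex_inj (inv_inj (flipK i))) /= -sumrN; apply: eq_bigr => x _.
rewrite !walsh_flip mulrACA -signr_addb.
have -> : (s 0 i != 0) (+) (t 0 i != 0) = true.
  by case: (s 0 i) (t 0 i) sti => [[|[|[]]] // ?] [[|[|[]]]].
by rewrite mulN1r.
Qed.

Lemma sum_sign_weight s : \sum_i (-1) ^+ (s 0 i != 0) = D%:R - 2%:R * (weight s)%:R :> F.
Proof.
rewrite (eq_bigr (fun i => 1 - 2%:R * (s 0 i != 0)%:R)) => [|i _]; last first.
  by case: eqP => _; rewrite ?mulr0 ?subr0 ?mulr1 //; ring.
rewrite sumrB sumr_const card_ord -mulr_sumr /weight -sum1_card natr_sum.
rewrite [X in _ = _ - _ * X]big_mkcond /=; congr (_ - _ * _).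
by apply: eq_bigr => i _; rewrite inE; case: eqP.
Qed.

Lemma cube_diag (G := hypercube D) :
  exists2 P : 'M[F]_#|G|, P \in unitmx &
  P *m adjacency_mx G F
    = diag_mx (\row_i (D%:R - 2%:R * (weight (enum_val i))%:R)) *m P.
Proof.
pose P : 'M[F]_#|G| := \matrix_(i, j) walsh (enum_val i) (enum_val j).
have nz : #|G|%:R != 0 :> F.
  by rewrite pnatr_eq0 -lt0n; apply/card_gt0P; exists (0 : 'rV['F_2]_D).
(* [P] is a symmetric Hadamard matrix: orthogonality makes its square a nonzero scalar, whence
   invertibility. *)
have PP : P *m P = #|G|%:R%:M.
  apply/matrixP=> i j; rewrite !mxE.
  under eq_bigr do rewrite !mxE [walsh _ (enum_val j)]walshC.
  rewrite [LHS](sum_enum_val (fun x : G => walsh (enum_val i) x * walsh (enum_val j) x)).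
  by rewrite walsh_orthogonal (inj_eq enum_val_inj) natrM mulr_natr.
exists P.
  have : P *m (#|G|%:R^-1 *: P) = 1%:M.
    by rewrite -scalemxAr PP scale_scalar_mx mulVf.
  by case/mulmx1_unit.
apply/matrixP=> i j; rewrite mul_diag_mx !mxE.
under eq_bigr do rewrite !mxE.
rewrite [LHS](sum_enum_val (fun x : G => walsh (enum_val i) x * (adj x (enum_val j))%:R)).
(* Each row of [P] is a left eigenvector: flipping coordinate [k] multiplies the character by a
   sign, and these signs add up to the eigenvalue. *)
transitivity (\sum_(x | cube_adj (enum_val j) x) walsh (enum_val i) x).
  rewrite [RHS]big_mkcond /=; apply: eq_bigr => x _; rewrite cube_adj_sym.
  by case: cube_adj; rewrite ?mulr1 ?mulr0.
rewrite sum_cube_adj -sum_sign_weight mulr_suml.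
by apply: eq_bigr => k _; rewrite walsh_flip.
Qed.

Lemma cube_char_poly (G := hypercube D) :
  char_poly (adjacency_mx G F)
    = \prod_(k < D.+1) ('X - (D%:R - 2%:R * k%:R)%:P) ^+ 'C(D, k)
  /\ char_poly (laplacian_mx G F)
    = \prod_(k < D.+1) ('X - (- (2%:R * k%:R))%:P) ^+ 'C(D, k).
Proof.
have [P uP PA] := cube_diag.
apply: (level_char_poly (G := G) (lv := weight) weight_le _ cube_degree uP PA).
by move=> k _; apply: card_weight.
Qed.

End Cube.

Theorem theorem1p6 (F : numClosedFieldType) (D : nat) (G : sgraph)
    (hG : twisted_hypercube D G) :
  adjacency_cospectral F G (hypercube D) /\ laplacian_cospectral F G (hypercube D).
Proof.
have [GA GL] := twisted_char_poly F hG; have [HA HL] := cube_char_poly D F.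
by split=> a; rewrite /eigenvalue_mult ?GA ?GL ?HA ?HL.
Qed.
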